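(* For $v\in\mathbb{C}$ and $n_1,n_2,n_3,n_1',n_2',n_3'\in\mathbb{Z}_{\ge0}$ define $$T_{n_1n_2n_3}^{n_1'n_2'n_3'}(v)=v^{n_2'}(1-v)^{n_2-n_2'}\binom{n_2}{n_2'}\mathbf{1}_{n_2'\le n_2}\mathbf{1}_{n_1+n_2=n_1'+n_2'}\mathbf{1}_{n_2+n_3=n_2'+n_3'} .$$ Let $S_{n_1n_2n_3}^{n_1'n_2'n_3'}(v)$ be the ($q$-dependent) weights defined in the context. Then: 1. For any fixed $v\in\mathbb{C}$ and $n_1,n_2,n_3,n_1',n_2',n_3'\in\mathbb{Z}_{\ge0}$, $\displaystyle\lim_{q\to1}S_{n_1n_2n_3}^{n_1'n_2'n_3'}(v)=T_{n_1n_2n_3}^{n_1'n_2'n_3'}(v)$. 2. For any fixed $v\in\mathbb{C}$ and $n_1,n_2,n_3\in\mathbb{Z}_{\ge0}$, $\displaystyle\sum_{(n_1',n_2',n_3')\in\mathbb{Z}_{\ge0}^3}T_{n_1n_2n_3}^{n_1'n_2'n_3'}(v)=1$. 3. For any fixed $v,w\in\mathbb{C}$ and $n_1,\dots,n_6,n_1'',\dots,n_6''\in\mathbb{Z}_{\ge0}$, the weights satisfy the (non-dynamical) tetrahedron equation $$\begin{aligned} &\sum_{\mathbf{n}'}T_{n_1n_2n_3}^{n_1'n_2'n_3'}(w)\,T_{n_1'n_4n_5}^{n_1''n_4'n_5'}(w)\,T_{n_3'n_5'n_6'}^{n_3''n_5''n_6''}(v)\,T_{n_2'n_4'n_6}^{n_2''n_4''n_6'}(v)\\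 &\qquad=\sum_{\mathbf{n}'}T_{n_3n_5n_6}^{n_3'n_5'n_6'}(v)\,T_{n_2n_4n_6'}^{n_2'n_4'n_6''}(v)\,T_{n_1n_4'n_5'}^{n_1'n_4''n_5''}(w)\,T_{n_1'n_2'n_3'}^{n_1''n_2''n_3''}(w), \end{aligned}$$ where both sums are over $\mathbf{n}'=(n_1',\dots,n_6')\in\mathbb{Z}_{\ge0}^6$. 4. If $v\in(0,1)$, then $T_{n_1n_2n_3}^{n_1'n_2'n_3'}(v)\ge0$ for all $n_1,n_2,n_3,n_1',n_2',n_3'\in\mathbb{Z}_{\ge0}$.
   Context: For $a\in\mathbb{C}$ and $k\in\mathbb{Z}_{\ge0}$ let $(a;q^2)_k=\prod_{j=0}^{k-1}(1-q^{2j}a)$, and let ${}_2\varphi_1\big(\begin{smallmatrix}a_1,a_2\\ b_1\end{smallmatrix}\big|q^2,z\big)=\sum_{k\ge0}\frac{(a_1;q^2)_k(a_2;q^2)_k}{(q^2;q^2)_k(b_1;q^2)_k}z^k$. For $q,v\in\mathbb{C}$ and nonnegative integers $n_1,n_2,n_3,n_1',n_2',n_3'$, $$\begin{aligned} S_{n_1n_2n_3}^{n_1'n_2'n_3'}(v)=\ & q^{(n_1+n_3+n_1'+n_3'+2)n_2-2(n_1'+1)n_2'}\,\frac{(q^2;q^2)_{n_1}(q^{-2n_1'};q^2)_{n_2}(q^2;q^2)_{n_3}}{(q^2;q^2)_{n_1'}(q^2;q^2)_{n_2'}(q^2;q^2)_{n_3'}}\,v^{n_2'}\,\frac{(vq^{-2n_1'};q^2)_{n_3'}}{(v;q^2)_{n_3}}\\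 &\times{}_2\varphi_1\Big(\begin{matrix}q^{-2n_2},\,q^{2n_1+2}\\ q^{2(n_1'-n_2+1)}\end{matrix}\Big|\,q^2,q^{-2n_3}\Big)\,\mathbf{1}_{n_1+n_2=n_1'+n_2'}\,\mathbf{1}_{n_2+n_3=n_2'+n_3'}, \end{aligned}$$ where the product of $(q^{-2n_1'};q^2)_{n_2}$ with the series is read as $$(q^{-2n_1'};q^2)_{n_2}\;{}_2\varphi_1(\cdots)=(q^2;q^2)_{n_2}\sum_{k=0}^{n_2}\frac{(q^{-2n_1'};q^2)_{n_2-k}(q^{2n_1+2};q^2)_k}{(q^2;q^2)_{n_2-k}(q^2;q^2)_k}\,q^{-2k(n_1'+n_3+1)} .$$
   Formalization: Part 1 is stated only when v ≠ 1 or n_3 = 0: for v = 1 and n_3 ≥ 1 the denominator (v;q^2)_{n_3} of S vanishes for every q, so S is undefined (e.g. S_{1,0,1}^{1,0,1}(v) = (1 - v q^{-2})/(1 - v)). *)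

(* Defs.v *)
From HB Require Import structures.
From mathcomp Require Import all_boot all_order all_algebra.
From mathcomp Require Import complex.
From mathcomp Require Import all_classical all_reals all_analysis.

Set Implicit Arguments.
Unset Strict Implicit.
Unset Printing Implicit Defensive.

Import Order.TTheory GRing.Theory Num.Theory.
Import numFieldNormedType.Exports.

Local Open Scope classical_set_scope.
Local Open Scope ring_scope.

(* The field R[i], packaged as a numClosedFieldType so that the topology induced
   by the modulus, which MathComp-Analysis provides for every such type, is
   inferred. Its order is partial: [x <= y] means that y - x is a nonnegative
   real number. *)
Definition CC (R : realType) : numClosedFieldType := R[i]%type.

Definition qpoch (F : fieldType) (a q : F) (k : nat) : F :=
  \prod_(j < k) (1 - q ^+ j * a).

(* The product (q^(-2 m1); q^2)_(n2) * 2phi1(q^(-2 n2), q^(2 n1 + 2);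
   q^(2 (m1 - n2 + 1)) | q^2, q^(-2 n3)), where the denominators
   (q^(2 (m1 - n2 + 1)); q^2)_k of the series, which may vanish, are cancelled
   against the prefactor. *)
Definition qpoch_phi (F : fieldType) (q : F) (n1 n2 n3 m1 : nat) : F :=
  qpoch (q ^+ 2) (q ^+ 2) n2 *
  \sum_(0 <= k < n2.+1)
    qpoch (q ^ (- (2 * m1)%:Z)) (q ^+ 2) (n2 - k) *
    qpoch (q ^+ (2 * n1 + 2)) (q ^+ 2) k /
    (qpoch (q ^+ 2) (q ^+ 2) (n2 - k) * qpoch (q ^+ 2) (q ^+ 2) k) *
    q ^ (- (2 * k * (m1 + n3 + 1))%:Z).

(* In Sweight and Tweight, n1 n2 n3 are the lower indices and m1 m2 m3 the
   upper (primed) ones. *)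
Definition Sweight (F : fieldType) (q v : F) (n1 n2 n3 m1 m2 m3 : nat) : F :=
  q ^ (((n1 + n3 + m1 + m3 + 2) * n2)%:Z - (2 * (m1 + 1) * m2)%:Z) *
  (qpoch (q ^+ 2) (q ^+ 2) n1 * qpoch (q ^+ 2) (q ^+ 2) n3 /
   (qpoch (q ^+ 2) (q ^+ 2) m1 * qpoch (q ^+ 2) (q ^+ 2) m2 *
    qpoch (q ^+ 2) (q ^+ 2) m3)) *
  v ^+ m2 *
  (qpoch (v * q ^ (- (2 * m1)%:Z)) (q ^+ 2) m3 / qpoch v (q ^+ 2) n3) *
  qpoch_phi q n1 n2 n3 m1 *
  ((n1 + n2 == m1 + m2)%N%:R * (n2 + n3 == m2 + m3)%N%:R).

Definition Tweight (F : fieldType) (v : F) (n1 n2 n3 m1 m2 m3 : nat) : F :=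
  v ^+ m2 * (1 - v) ^+ (n2 - m2) * 'C(n2, m2)%:R *
  ((m2 <= n2)%N%:R * (n1 + n2 == m1 + m2)%N%:R * (n2 + n3 == m2 + m3)%N%:R).

(* \sum_(i \in [set: I]) f i is 0 by convention when f has infinite support, so
   equations between such sums are accompanied by this condition. *)
Definition finsupported (F : fieldType) (I : Type) (f : I -> F) : Prop :=
  finite_set [set i | f i != 0].

Notation nat6 := (nat * nat * nat * nat * nat * nat)%type.

(* Summands of the two sides of the tetrahedron equation: n holds the unprimed
   indices, k the primed (summed) ones and m the doubly primed ones. *)
Definition tetra_lhs (F : fieldType) (v w : F) (n m k : nat6) : F :=
  let: (n1, n2, n3, n4, n5, n6) := n in
  let: (m1, m2, m3, m4, m5, m6) := m in
  let: (k1, k2, k3, k4, k5, k6) := k in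
  Tweight w n1 n2 n3 k1 k2 k3 * Tweight w k1 n4 n5 m1 k4 k5 *
  Tweight v k3 k5 k6 m3 m5 m6 * Tweight v k2 k4 n6 m2 m4 k6.

Definition tetra_rhs (F : fieldType) (v w : F) (n m k : nat6) : F :=
  let: (n1, n2, n3, n4, n5, n6) := n in
  let: (m1, m2, m3, m4, m5, m6) := m in
  let: (k1, k2, k3, k4, k5, k6) := k in
  Tweight v n3 n5 n6 k3 k5 k6 * Tweight v n2 n4 k6 k2 k4 m6 *
  Tweight w n1 k4 k5 k1 m4 m5 * Tweight w k1 k2 k3 m1 m2 m3.

(* Main.v *)
(* Part 1: with p = q^2, the sum in S is rewritten, by expanding the powers of
   p^(-n3-1) by the Gauss binomial formula and then summing by the
   q-Chu-Vandermonde formula, as a sum over j whose j-th term contains (1 - p)^j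
   and vanishes for j < m1 - n1. The total power of 1 - p in S is then n1 - m1
   (truncated), and the other factors are continuous at q = 1, where only the
   term j = m1 - n1 survives.
   Parts 2 and 3: T is a Markov kernel, multiplicative in the sense that its
   generating function is x1^n1 (v x2 + (1 - v) x1 x3)^n2 x3^n3. Both sides of
   the tetrahedron equation are compositions of such kernels, so it is enough to
   compare the two substitutions on the generators; both send
   x4 to w v x4 + w (1 - v) x2 x6 + (1 - w) v x1 x5 + (1 - w) (1 - v) x1 x3 x6,
   x2 to w x2 + (1 - w) x1 x3 and x5 to v x5 + (1 - v) x3 x6. *)
Require Import Defs.
From mathcomp Require Import all_boot all_order all_algebra.
From mathcomp Require Import complex.
From mathcomp Require Import all_classical all_reals all_analysis.
From mathcomp Require Import ring zify.
Import Order.TTheory GRing.Theory Num.Theory.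
Import numFieldNormedType.Exports.
Local Open Scope classical_set_scope.
Local Open Scope ring_scope.

(** * q-Pochhammer symbols *)
Lemma qpochS (F : fieldType) (a q : F) k :
  qpoch a q k.+1 = qpoch a q k * (1 - q ^+ k * a).
Proof. by rewrite /qpoch big_ord_recr. Qed.

Lemma qpochD (F : fieldType) (a q : F) i j :
  qpoch a q (i + j) = qpoch a q i * qpoch (a * q ^+ i) q j.
Proof.
rewrite /qpoch big_split_ord; congr (_ * _); apply: eq_bigr => k _ /=.
by rewrite exprD; ring.
Qed.

(** The hypothesis says that $q^i \ne 1$ for $1 \le i \le n$; it serves below as the genericity
    condition on [q], and passes to smaller indices because the product of length [i] divides that
    of length [n]. *)
Lemma qpoch_neq0 (F : fieldType) (q : F) n i :
  qpoch q q n != 0 -> (i <= n)%N -> qpoch q q i != 0.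
Proof.
by move=> n0 /subnKC ni; move: n0; rewrite -ni qpochD mulf_eq0 negb_or => /andP[].
Qed.

(** The homogeneous form of $x^k (y/x; q)_k$, which still makes sense at $x = 0$ and treats powers
    ($y = 0$) and q-Pochhammer symbols ($x = 1$) alike. *)
Definition hpoch (F : fieldType) (q x y : F) k : F :=
  \prod_(j < k) (x - q ^+ j * y).
Arguments hpoch {F} q x y k.

Lemma hpochS (F : fieldType) (q x y : F) k :
  hpoch q x y k.+1 = hpoch q x y k * (x - q ^+ k * y).
Proof. by rewrite /hpoch big_ord_recr. Qed.

Lemma hpochZ (F : fieldType) (q x y : F) k :
  hpoch q x (x * y) k = x ^+ k * qpoch y q k.
Proof.
rewrite /hpoch /qpoch -[in x ^+ k](card_ord k) -prodr_const -big_split.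
by apply: eq_bigr => j _ /=; ring.
Qed.

Lemma hpoch1 (F : fieldType) (q x : F) k : hpoch q 1 x k = qpoch x q k.
Proof. by []. Qed.

Lemma hpoch0 (F : fieldType) (q x : F) k : hpoch q x 0 k = x ^+ k.
Proof.
by rewrite -(mulr0 x) hpochZ /qpoch big1 ?mulr1// => j _; rewrite mulr0 subr0.
Qed.

(* With z = 0 this is the Gauss binomial formula, with (x, y, z) = (1, a, a b)
   the q-Chu-Vandermonde sum. The induction step rests on
   x - q^N z = (x - q^(N-i) y) + q^(N-i) (y - q^i z). *)
Lemma hpoch_vandermonde (F : fieldType) (q x y z : F) N :
  qpoch q q N != 0 ->
  hpoch q x z N / qpoch q q N =
  \sum_(i < N.+1) hpoch q x y (N - i) / qpoch q q (N - i) *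
                  (hpoch q y z i / qpoch q q i).
Proof.
elim: N => [|N IH] qN0.
  by rewrite big_ord1 subn0 /hpoch /qpoch !big_ord0 divr1 mulr1.
have qne0 i : (i <= N)%N -> qpoch q q i != 0 /\ 1 - q ^+ i.+1 != 0.
  move=> iN; have := @qpoch_neq0 _ _ _ i.+1 qN0 iN.
  by rewrite qpochS mulf_eq0 negb_or exprSr => /andP[].
set u := fun i => hpoch q x y i / qpoch q q i.
set w := fun i => hpoch q y z i / qpoch q q i.
have uS i : (i <= N)%N -> (1 - q ^+ i.+1) * u i.+1 = (x - q ^+ i * y) * u i.
  move=> /qne0[q1 q2]; rewrite /u hpochS qpochS -exprSr.
  by field; rewrite q1 q2.
have wS i : (i <= N)%N -> (1 - q ^+ i.+1) * w i.+1 = (y - q ^+ i * z) * w i.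
  move=> /qne0[q1 q2]; rewrite /w hpochS qpochS -exprSr.
  by field; rewrite q1 q2.
have [q1 q2] := qne0 N (leqnn N).
apply: (mulfI q2).
transitivity ((x - q ^+ N * z) * (hpoch q x z N / qpoch q q N)).
  by rewrite hpochS qpochS -exprSr; field; rewrite q1 q2.
rewrite IH // -/u -/w !mulr_sumr.
under [RHS]eq_bigr => i _.
  have -> : (1 - q ^+ N.+1) * (u (N.+1 - i)%N * w i) =
    (1 - q ^+ (N.+1 - i)) * u (N.+1 - i)%N * w i +
    q ^+ (N.+1 - i) * u (N.+1 - i)%N * ((1 - q ^+ i) * w i).
    rewrite -{1}(@subnK i N.+1 (ltn_ord i)) exprD; ring.
  over.
(* The term $i = N+1$ of the first sum and the term $i = 0$ of the second contain $1 - q^0$; without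
   them, and after a shift of the second, both sums run over $i \le N$. *)
rewrite big_split /= [X in _ = X + _]big_ord_recr [X in _ = _ + X]big_ord_recl /=.
rewrite subnn expr0 subrr !(mul0r, mulr0) addr0 add0r -big_split /=.
apply: eq_bigr => i _; have iN : (i <= N)%N by rewrite -ltnS.
rewrite subSn // uS ?leq_subr// /bump add1n subSS wS // -/(u _) -/(w _).
rewrite -{1}(subnK iN) exprD; ring.
Qed.

Lemma qpoch_vandermonde (F : fieldType) (q a b : F) N :
  qpoch q q N != 0 ->
  qpoch (a * b) q N / qpoch q q N =
  \sum_(i < N.+1) qpoch a q (N - i) / qpoch q q (N - i) *
                  (qpoch b q i / qpoch q q i) * a ^+ i.
Proof.
move=> qN0; rewrite -hpoch1 (hpoch_vandermonde _ _ _ a) //.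
by apply: eq_bigr => i _; rewrite hpochZ hpoch1; ring.
Qed.

(* Expand y^k by Gauss in the products hpoch q y 1 j, then sum over k. *)
Lemma qpoch_sum_transform (F : fieldType) (q a b y : F) N :
  qpoch q q N != 0 ->
  \sum_(k < N.+1) qpoch a q (N - k) / qpoch q q (N - k) *
                  (qpoch b q k / qpoch q q k) * (a * y) ^+ k =
  \sum_(j < N.+1) hpoch q y 1 j * a ^+ j * qpoch b q j *
    qpoch (a * b * q ^+ j) q (N - j) / (qpoch q q j * qpoch q q (N - j)).
Proof.
move=> qN0; have q0 i := @qpoch_neq0 _ q N i qN0.
have gauss k : (k <= N)%N -> y ^+ k = qpoch q q k *
    \sum_(0 <= j < N.+1 | (j <= k)%N)
      hpoch q y 1 j / (qpoch q q j * qpoch q q (k - j)).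
  move=> kN; rewrite (eq_bigl (fun j => true && (j < k.+1)%N)) //.
  rewrite -big_nat_widen // big_mkord.
  have := @hpoch_vandermonde _ q y 1 0 k (q0 _ kN).
  rewrite hpoch0 => /(canRL (divfK (q0 _ kN))) ->.
  rewrite mulrC (reindex_inj rev_ord_inj) /=; congr (_ * _).
  apply: eq_bigr => i _; rewrite subSS subKn -1?ltnS //.
  rewrite hpoch0 expr1n invfM; ring.
rewrite -(big_mkord predT (fun k => qpoch a q (N - k) / qpoch q q (N - k) *
  (qpoch b q k / qpoch q q k) * (a * y) ^+ k)).
rewrite -(big_mkord predT (fun j => hpoch q y 1 j * a ^+ j * qpoch b q j *
  qpoch (a * b * q ^+ j) q (N - j) / (qpoch q q j * qpoch q q (N - j)))).
under eq_big_nat => k /andP[_ kN].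
  rewrite exprMn (gauss _ kN) !mulr_sumr; over.
rewrite (exchange_big_dep_nat predT) //=.
apply: eq_big_nat => j /andP[_ jN].
have jN' : (j <= N)%N by [].
(* The inner sum starts at $k = j$; after the shift $k = j + i$ it is the q-Chu-Vandermonde sum of
   length $N - j$ with $b q^j$ in place of $b$. *)
rewrite (big_cat_nat (n := j)) //= 1?ltnW //.
rewrite big_nat_cond big1 ?add0r; last by move=> i; lia.
rewrite -{1}[j]add0n big_addn (subSn jN') big_mkord.
transitivity (hpoch q y 1 j * a ^+ j * qpoch b q j / qpoch q q j *
   (qpoch (a * (b * q ^+ j)) q (N - j) / qpoch q q (N - j))); last first.
  have -> : a * (b * q ^+ j) = a * b * q ^+ j by rewrite mulrA.
  by rewrite invfM; ring.
rewrite qpoch_vandermonde ?q0 ?leq_subr// mulr_sumr.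
apply: eq_big => [i|i _]; first by lia.
have iN : (i <= N - j)%N by rewrite -ltnS.
rewrite addnK (addnC i j) qpochD exprD subnDA.
have := q0 (j + i)%N ltac:(lia); have := q0 i ltac:(lia).
have := q0 j ltac:(lia); have := q0 (N - j - i)%N ltac:(lia).
by move=> h1 h2 h3 h4; field; rewrite h1 h2 h3 h4.
Qed.

(** * The limit q -> 1 *)
(** The q-integer $[n]_q$, written as a polynomial so that it has the value $n$ at $q = 1$; [qrise]
    is the rising factorial $[a]_q [a+1]_q \cdots [a+k-1]_q$. *)
Definition qint (F : fieldType) (q : F) (n : nat) : F := \sum_(i < n) q ^+ i.
Arguments qint {F} q n.

Definition qrise (F : fieldType) (q : F) (a k : nat) : F :=
  \prod_(j < k) qint q (a + j).
Arguments qrise {F} q a k.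

Lemma qpoch_qrise (F : fieldType) (q : F) a k :
  qpoch (q ^+ a) q k = (1 - q) ^+ k * qrise q a k.
Proof.
rewrite /qpoch /qrise -[in X in X * _](card_ord k) -prodr_const -big_split.
apply: eq_bigr => j _ /=.
by rewrite -exprD -[LHS]opprB addnC subrX1 -mulNr opprB.
Qed.

Lemma qpoch_exprVn (F : fieldType) (q : F) m k : q != 0 -> (m < k)%N ->
  qpoch (q ^- m) q k = 0.
Proof.
move=> q0 mk; rewrite /qpoch (bigD1 (Ordinal mk)) //=.
by rewrite divff ?expf_neq0 // subrr mul0r.
Qed.

(* qpoch_phi divided by the power of 1 - q^2 it contains; p stands for q^2. *)
Definition qphi_quot (F : fieldType) (p : F) (n1 n2 n3 m1 : nat) : F :=
  qrise p 1 n2 * \sum_(j < n2.+1 | (m1 - n1 <= j)%N)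
    (1 - p) ^+ (j - (m1 - n1)) *
    (p ^- (j * (m1 + n3 + 1)) * qrise p (n3 + 1) j * qrise p (n1 + 1) j *
     qrise p (j + n1 + 1 - m1) (n2 - j) / (qrise p 1 j * qrise p 1 (n2 - j))).
Arguments qphi_quot {F} p n1 n2 n3 m1.

(** This is [qpoch_sum_transform] with $a = p^{-m_1}$, $b = p^{n_1+1}$, $y = p^{-n_3-1}$. In the
    j-th term [hpoch] and the symbol of $b$ each give $(1-p)^j$, the remaining symbol gives
    $(1-p)^{n_2-j}$, and the denominators remove $(1-p)^{n_2}$. *)
Lemma qpoch_phi_quot (F : fieldType) (q : F) n1 n2 n3 m1 :
  q != 0 -> qpoch (q ^+ 2) (q ^+ 2) n2 != 0 -> (m1 <= n1 + n2)%N ->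
  qpoch_phi q n1 n2 n3 m1 =
  (1 - q ^+ 2) ^+ n2 * (1 - q ^+ 2) ^+ (m1 - n1) * qphi_quot (q ^+ 2) n1 n2 n3 m1.
Proof.
move=> q0 qn0 le; rewrite /qpoch_phi /qphi_quot.
have qV n : q ^ (- (2 * n)%:Z) = (q ^+ 2) ^- n by rewrite -exprnN exprM.
have -> : q ^+ (2 * n1 + 2) = (q ^+ 2) ^+ (n1 + 1).
  by rewrite -exprM; congr (_ ^+ _); lia.
rewrite qV; set p := q ^+ 2 in qV qn0 *.
have p0 : p != 0 by rewrite expf_neq0.
clearbody p.
have rise0 j : (j <= n2)%N -> qrise p 1 j != 0 /\ (1 - p) ^+ j != 0.
  move=> jn; have := @qpoch_neq0 _ _ _ j qn0 jn.
  by rewrite -{1}[p]expr1 qpoch_qrise mulf_eq0 negb_or => /andP[].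
have pp i : qpoch p p i = (1 - p) ^+ i * qrise p 1 i.
  by rewrite -{1}[p]expr1 qpoch_qrise.
rewrite big_mkord.
transitivity (qpoch p p n2 * \sum_(k < n2.+1)
    qpoch (p ^- m1) p (n2 - k) / qpoch p p (n2 - k) *
    (qpoch (p ^+ (n1 + 1)) p k / qpoch p p k) * (p ^- m1 * p ^- (n3 + 1)) ^+ k).
  congr (_ * _); apply: eq_bigr => k _; rewrite -mulnA qV.
  rewrite invfM -!exprVn -exprD [(k * _)%N]mulnC exprM.
  have -> : (m1 + n3 + 1 = m1 + (n3 + 1))%N by lia.
  by congr (_ * _); ring.
rewrite qpoch_sum_transform // pp -[LHS]mulrA -[RHS]mulrA; congr (_ * _).
rewrite [RHS]mulrCA; congr (_ * _).
rewrite mulr_sumr [RHS]big_mkcond; apply: eq_bigr => j _.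
have jn : (j <= n2)%N by rewrite -ltnS.
(* Here $1 = y\,p^{n_3+1}$, so [hpochZ] takes out $y^j$. *)
have -> : hpoch p (p ^- (n3 + 1)) 1 j =
  p ^- (j * (n3 + 1)) * ((1 - p) ^+ j * qrise p (n3 + 1) j).
  rewrite -{1}(mulVf (expf_neq0 (n3 + 1) p0)) hpochZ qpoch_qrise.
  by rewrite -!exprVn mulnC exprM.
(* For $j < m_1 - n_1$ the symbol $(a b p^j; p)_{n_2-j}$ has base $p^{-(m_1-n_1-1-j)}$ and contains
   a zero factor, because $m_1 \le n_1 + n_2$. *)
case: leqP => mj; last first.
  have -> : p ^- m1 * p ^+ (n1 + 1) * p ^+ j = p ^- (m1 - n1 - 1 - j).
    have -> : p ^+ m1 = p ^+ (m1 - n1 - 1 - j) * p ^+ (n1 + 1) * p ^+ j.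
      by rewrite -!exprD; congr (_ ^+ _); lia.
    by field; rewrite !expf_neq0.
  by rewrite qpoch_exprVn ?(mulr0, mul0r) //; lia.
have -> : p ^- m1 * p ^+ (n1 + 1) * p ^+ j = p ^+ (j + n1 + 1 - m1).
  apply: (mulfI (expf_neq0 m1 p0)); rewrite !mulrA mulfV ?expf_neq0 // mul1r.
  by rewrite -!exprD; congr (_ ^+ _); lia.
rewrite !qpoch_qrise !pp -!exprVn.
have -> : (j * (m1 + n3 + 1) = m1 * j + j * (n3 + 1))%N by lia.
rewrite exprD [_ ^+ (m1 * j)]exprM.
have [r1 e1] := rise0 j jn; have [r2 e2] := rise0 (n2 - j)%N (leq_subr _ _).
have eD : (1 - p) ^+ j = (1 - p) ^+ (m1 - n1) * (1 - p) ^+ (j - (m1 - n1)).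
  by rewrite -exprD; congr (_ ^+ _); lia.
move: e1; rewrite eD mulf_eq0 negb_or => /andP[d1 d2].
by field; rewrite r1 r2 e2 d1 d2.
Qed.

(* A form of Sweight that makes sense, and is continuous, at q = 1. *)
Definition Sweight_quot (F : fieldType) (q v : F) (n1 n2 n3 m1 m2 m3 : nat) : F :=
  let p := q ^+ 2 in
  (1 - p) ^+ (n1 - m1) *
  (q ^ (((n1 + n3 + m1 + m3 + 2) * n2)%:Z - (2 * (m1 + 1) * m2)%:Z) *
   (qrise p 1 n1 * qrise p 1 n3 /
    (qrise p 1 m1 * qrise p 1 m2 * qrise p 1 m3)) *
   v ^+ m2 *
   (qpoch (v * q ^ (- (2 * m1)%:Z)) p m3 / qpoch v p n3) *
   qphi_quot p n1 n2 n3 m1) *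
  ((n1 + n2 == m1 + m2)%N%:R * (n2 + n3 == m2 + m3)%N%:R).
Arguments Sweight_quot {F} q v n1 n2 n3 m1 m2 m3.

Lemma Sweight_quotE (F : fieldType) (q v : F) n1 n2 n3 m1 m2 m3 :
  q != 0 -> qpoch (q ^+ 2) (q ^+ 2) (n1 + n2 + n3) != 0 ->
  Sweight q v n1 n2 n3 m1 m2 m3 = Sweight_quot q v n1 n2 n3 m1 m2 m3.
Proof.
rewrite /Sweight /Sweight_quot => q0 qn0.
case: eqP => [nm12|_]; last by rewrite mul0r !mulr0.
case: eqP => [nm23|_]; last by rewrite !mulr0.
have qn2 : qpoch (q ^+ 2) (q ^+ 2) n2 != 0 by apply: qpoch_neq0 qn0 _; lia.
have le : (m1 <= n1 + n2)%N by lia.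
rewrite !mulr1 (@qpoch_phi_quot _ _ _ _ _ _ q0 qn2 le).
set p := q ^+ 2 in qn0 *.
have pp i : qpoch p p i = (1 - p) ^+ i * qrise p 1 i.
  by rewrite -{1}[p]expr1 qpoch_qrise.
have rise0 j : (j <= n1 + n2 + n3)%N -> qrise p 1 j != 0 /\ (1 - p) ^+ j != 0.
  move=> jn; have := @qpoch_neq0 _ _ _ j qn0 jn.
  by rewrite pp mulf_eq0 negb_or => /andP[].
have [r1 e1] := rise0 m1 ltac:(lia); have [r2 e2] := rise0 m2 ltac:(lia).
have [r3 e3] := rise0 m3 ltac:(lia); rewrite !pp.
(* The balance of powers of $1-p$: in truncated subtraction $n_1 + (m_1 - n_1) = m_1 + (n_1 - m_1)$,
   and $n_2 + n_3 = m_2 + m_3$. *)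
have e : (1 - p) ^+ n1 * (1 - p) ^+ n3 * ((1 - p) ^+ n2 * (1 - p) ^+ (m1 - n1)) =
    (1 - p) ^+ (n1 - m1) * ((1 - p) ^+ m1 * (1 - p) ^+ m2 * (1 - p) ^+ m3).
  by rewrite -!exprD; congr (_ ^+ _); lia.
set X := qphi_quot _ _ _ _ _; set Y := _ / qpoch v p n3; set Z := q ^ _.
transitivity ((1 - p) ^+ n1 * (1 - p) ^+ n3 * ((1 - p) ^+ n2 * (1 - p) ^+ (m1 - n1))
  / ((1 - p) ^+ m1 * (1 - p) ^+ m2 * (1 - p) ^+ m3) *
  (Z * (qrise p 1 n1 * qrise p 1 n3 / (qrise p 1 m1 * qrise p 1 m2 * qrise p 1 m3)) *
   v ^+ m2 * Y * X)).
  by field; rewrite r1 r2 r3 e1 e2 e3.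
by rewrite e; congr (_ * _); rewrite mulfK // !mulf_neq0.
Qed.

Lemma qint1 (F : fieldType) n : qint (1 : F) n = n%:R.
Proof.
rewrite /qint (eq_bigr (fun=> 1)) ?sumr_const ?card_ord // => i _.
by rewrite expr1n.
Qed.

Lemma qrise1 (F : fieldType) a k : qrise (1 : F) (a + 1) k * a`!%:R = (a + k)`!%:R.
Proof.
elim: k => [|k IH]; first by rewrite /qrise big_ord0 mul1r addn0.
rewrite /qrise big_ord_recr /= -/(qrise 1 (a + 1) k) mulrAC IH qint1 -natrM.
by rewrite [in RHS]addnS factS [in RHS]mulnC; congr (_ * _)%:R; lia.
Qed.

Lemma qrise11 (F : fieldType) k : qrise (1 : F) 1 k = k`!%:R.
Proof. by have := @qrise1 F 0 k; rewrite fact0 mulr1. Qed.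

Lemma natr_fact_neq0 (F : numDomainType) k : k`!%:R != 0 :> F.
Proof. by rewrite pnatr_eq0 -lt0n fact_gt0. Qed.

Lemma qpoch1 (F : fieldType) (v : F) k : qpoch v 1 k = (1 - v) ^+ k.
Proof.
rewrite /qpoch -[in RHS](card_ord k) -prodr_const.
by apply: eq_bigr => j _; rewrite expr1n mul1r.
Qed.

(** At $p = 1$ the power of $1-p$ kills every term except $j = m_1 - n_1 = n_2 - m_2$, whose rising
    factorials are quotients of factorials. The identity is kept free of division, with $m_2!$ on
    both sides to match [bin_fact]. *)
Lemma qphi_quot1 (F : numFieldType) n1 n2 n3 m1 m2 m3 :
  (n1 + n2 = m1 + m2)%N -> (n2 + n3 = m2 + m3)%N -> (n1 <= m1)%N ->
  qphi_quot (1 : F) n1 n2 n3 m1 * n1`!%:R * n3`!%:R * (n2 - m2)`!%:R * m2`!%:R =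
  n2`!%:R * m1`!%:R * m3`!%:R * m2`!%:R.
Proof.
move=> e12 e23 le; rewrite /qphi_quot subrr.
have Dn : (m1 - n1 < n2.+1)%N by lia.
rewrite (bigD1 (Ordinal Dn)) /=; last by [].
rewrite big1 ?addr0; last first.
  move=> j /andP[jD]; rewrite -val_eqE /= => jne.
  by rewrite expr0n subn_eq0 leqNgt ltn_neqAle eq_sym jne jD mul0r.
rewrite subnn expr0 expr1n invr1 !mul1r.
have -> : (m1 - n1 + n1 + 1 - m1 = 1)%N by lia.
have -> : (m1 - n1 = n2 - m2)%N by lia.
have -> : (n2 - (n2 - m2) = m2)%N by lia.
rewrite !qrise11.
have h1 := @qrise1 F n1 (n2 - m2); have h3 := @qrise1 F n3 (n2 - m2).
rewrite (_ : n1 + (n2 - m2) = m1)%N in h1; last by lia.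
rewrite (_ : n3 + (n2 - m2) = m3)%N in h3; last by lia.
rewrite -h1 -h3; field.
by rewrite !natr_fact_neq0.
Qed.

Lemma Sweight_quot1 (F : numFieldType) (v : F) n1 n2 n3 m1 m2 m3 :
  v <> 1 \/ n3 = 0%N ->
  Sweight_quot 1 v n1 n2 n3 m1 m2 m3 = Tweight v n1 n2 n3 m1 m2 m3.
Proof.
rewrite /Sweight_quot /Tweight => hv.
case: eqP => [e12|_]; last by rewrite !(mul0r, mulr0).
case: eqP => [e23|_]; last by rewrite !(mul0r, mulr0).
rewrite !mulr1 expr1n !exp1rz mulr1 mul1r subrr !qpoch1 !qrise11.
(* If $n_2 < m_2$ then $m_1 < n_1$, and the factor $0^{n_1-m_1}$ vanishes, as does the indicator in
   [Tweight]. *)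
case: (leqP m2 n2) => m2n2; last first.
  by rewrite expr0n subn_eq0 leqNgt (_ : (m1 < n1)%N) ?mul0r ?mulr0 //; lia.
rewrite (_ : n1 - m1 = 0)%N ?expr0 ?mul1r ?mulr1; last by lia.
have -> : (1 - v) ^+ m3 / (1 - v) ^+ n3 = (1 - v) ^+ (n2 - m2).
  have -> : (m3 = n2 - m2 + n3)%N by lia.
  rewrite exprD mulfK // expf_eq0; case: hv => [/eqP v1|-> //].
  by rewrite subr_eq0 eq_sym (negPf v1) andbF.
have f0 := natr_fact_neq0 F.
have h := qphi_quot1 F _ _ _ _ _ _ e12 e23 ltac:(lia).
have b := bin_fact m2n2; move/(congr1 (fun n => n%:R : F)): b; rewrite !natrM => b.
move: h; rewrite -b.
set X := qphi_quot _ _ _ _ _ => h.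
have -> : X = 'C(n2, m2)%:R * m2`!%:R * m1`!%:R * m3`!%:R / (n1`!%:R * n3`!%:R).
  have nz : n1`!%:R * n3`!%:R * ((n2 - m2)`!%:R * m2`!%:R) != 0 :> F.
    by rewrite !mulf_neq0.
  apply: (mulIf nz).
  apply: (etrans (y := X * n1`!%:R * n3`!%:R * (n2 - m2)`!%:R * m2`!%:R)).
    by ring.
  by rewrite h; field; rewrite !f0.
by field; rewrite !f0.
Qed.

(** * Continuity of the rewritten weights at q = 1 *)

Section Limits.
Variables (K : numFieldType) (T : Type) (G : set_system T).
Context {GF : Filter G}.
Implicit Types f : T -> K.

Lemma cvg_bigsum (I : Type) (r : seq I) (P : pred I) (f : I -> T -> K) (l : I -> K) :
  (forall i, P i -> f i x @[x --> G] --> l i) ->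
  (\sum_(i <- r | P i) f i x) @[x --> G] --> \sum_(i <- r | P i) l i.
Proof.
move=> fl; elim: r => [|i r IH].
  by rewrite big_nil; under eq_fun do rewrite big_nil; exact: cvg_cst.
rewrite big_cons; under eq_fun do rewrite big_cons.
by case: ifP => // Pi; apply: cvgD => //; exact: fl.
Qed.

Lemma cvg_bigprod (I : Type) (r : seq I) (P : pred I) (f : I -> T -> K) (l : I -> K) :
  (forall i, P i -> f i x @[x --> G] --> l i) ->
  (\prod_(i <- r | P i) f i x) @[x --> G] --> \prod_(i <- r | P i) l i.
Proof.
move=> fl; elim: r => [|i r IH].
  by rewrite big_nil; under eq_fun do rewrite big_nil; exact: cvg_cst.
rewrite big_cons; under eq_fun do rewrite big_cons.
by case: ifP => // Pi; apply: cvgM => //; exact: fl.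
Qed.

Lemma cvg_exprn f (l : K) n : f x @[x --> G] --> l -> f x ^+ n @[x --> G] --> l ^+ n.
Proof.
move=> fl; elim: n => [|n IH].
  by rewrite expr0; under eq_fun do rewrite expr0; exact: cvg_cst.
by rewrite exprS; under eq_fun do rewrite exprS; exact: cvgM.
Qed.

Lemma cvg_exprz f (l : K) z : l != 0 ->
  f x @[x --> G] --> l -> f x ^ z @[x --> G] --> l ^ z.
Proof.
by case: z => n l0 fl; [|apply: cvgV; first by rewrite expf_neq0]; exact: cvg_exprn.
Qed.

Lemma cvg_qpoch f (p : T -> K) (a b : K) k :
  f x @[x --> G] --> a -> p x @[x --> G] --> b ->
  qpoch (f x) (p x) k @[x --> G] --> qpoch a b k.
Proof.
move=> fa pb; apply: cvg_bigprod => j _.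
by apply: cvgB; [exact: cvg_cst|apply: cvgM => //; exact: cvg_exprn].
Qed.

Lemma cvg_qrise (p : T -> K) (b : K) a k :
  p x @[x --> G] --> b -> qrise (p x) a k @[x --> G] --> qrise b a k.
Proof.
by move=> pb; apply: cvg_bigprod => j _; apply: cvg_bigsum => i _; exact: cvg_exprn.
Qed.

Lemma cvg_qphi_quot (p : T -> K) n1 n2 n3 m1 :
  p x @[x --> G] --> (1 : K) ->
  qphi_quot (p x) n1 n2 n3 m1 @[x --> G] --> qphi_quot (1 : K) n1 n2 n3 m1.
Proof.
move=> p1; apply: cvgM; first exact: cvg_qrise.
apply: cvg_bigsum => j _; apply: cvgM.
  by apply: cvg_exprn; apply: cvgB => //; exact: cvg_cst.
apply: cvgM; last first.
  apply: cvgV; first by rewrite !qrise11 mulf_neq0 // natr_fact_neq0.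
  by apply: cvgM; exact: cvg_qrise.
do 3![apply: cvgM; last exact: cvg_qrise].
by apply: cvgV; [rewrite expr1n oner_neq0|exact: cvg_exprn].
Qed.

(** All factors are continuous once the denominators are nonzero at $q = 1$: these are products of
    factorials, and $(1-v)^{n_3}$, which is where the condition on [v] and [n3] enters. *)
Lemma cvg_Sweight_quot (q : T -> K) (v : K) n1 n2 n3 m1 m2 m3 :
  v <> 1 \/ n3 = 0%N -> q x @[x --> G] --> (1 : K) ->
  Sweight_quot (q x) v n1 n2 n3 m1 m2 m3 @[x --> G] -->
  Tweight v n1 n2 n3 m1 m2 m3.
Proof.
move=> hv q1; rewrite -Sweight_quot1 //.
have p1 : q x ^+ 2 @[x --> G] --> (1 : K) ^+ 2 by exact: cvg_exprn.
have p1' : q x ^+ 2 @[x --> G] --> (1 : K) by move: p1; rewrite expr1n.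
apply: cvgM; last exact: cvg_cst.
apply: cvgM; first by apply: cvg_exprn; apply: cvgB => //; exact: cvg_cst.
apply: cvgM; last by rewrite [in X in _ --> X]expr1n; exact: cvg_qphi_quot.
apply: cvgM; last first.
  apply: cvgM.
    apply: cvg_qpoch => //; apply: cvgM; first exact: cvg_cst.
    by apply: cvg_exprz => //; exact: oner_neq0.
  apply: cvgV; last by apply: cvg_qpoch => //; exact: cvg_cst.
  rewrite expr1n qpoch1 expf_eq0; case: hv => [/eqP v1|-> //].
  by rewrite subr_eq0 eq_sym (negPf v1) andbF.
apply: cvgM; last exact: cvg_cst.
apply: cvgM; first by apply: cvg_exprz => //; exact: oner_neq0.
apply: cvgM; first by apply: cvgM; exact: cvg_qrise.
apply: cvgV; last by do 2?[apply: cvgM]; exact: cvg_qrise.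
by rewrite expr1n !qrise11 !mulf_neq0 ?natr_fact_neq0.
Qed.

End Limits.

(** The symbol factors as $(1-q)^N (1+q)^N$ times [qrise (q ^+ 2) 1 N]. The last two factors tend to
    $2^N$ and $N!$, and $1-q$ is nonzero off the centre. *)
Lemma near1_qpoch_neq0 (K : numFieldType) N :
  \forall q \near (1 : K)^', q != 0 /\ qpoch (q ^+ 2) (q ^+ 2) N != 0.
Proof.
have q1 : q @[q --> (1 : K)^'] --> (1 : K) by exact: nbhs_dnbhs.
have p1 : (q : K) ^+ 2 @[q --> (1 : K)^'] --> (1 : K).
  by rewrite -[X in _ --> X](expr1n K 2); exact: cvg_exprn.
have q0 : \forall q \near (1 : K)^', q != 0.
  exact: (cvgr_neq0 _ q1 (oner_neq0 K)).
have qN : \forall q \near (1 : K)^', 1 + q != 0.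
  have : 1 + q @[q --> (1 : K)^'] --> (1 : K) + 1 by apply: cvgD => //; exact: cvg_cst.
  by move=> /cvgr_neq0; apply; rewrite -mulr2n pnatr_eq0.
have qR : \forall q \near (1 : K)^', qrise (q ^+ 2) 1 N != 0.
  apply: (cvgr_neq0 _ (@cvg_qrise _ _ _ _ _ _ 1 N p1)).
  by rewrite qrise11 natr_fact_neq0.
have qn1 : \forall q \near (1 : K)^', q != 1 by exact: nbhs_dnbhs_neq.
near=> q; split; first by near: q.
rewrite -{1}[q ^+ 2]expr1 qpoch_qrise mulf_neq0 //; last by near: q.
rewrite expf_neq0 // -(expr1n K 2) subr_sqr mulf_neq0 //; last by near: q.
by rewrite subr_eq0 eq_sym; near: q.
Unshelve. all: by end_near. Qed.

Lemma cvg_Sweight (K : numFieldType) (v : K) n1 n2 n3 m1 m2 m3 :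
  v <> 1 \/ n3 = 0%N ->
  Sweight q v n1 n2 n3 m1 m2 m3 @[q --> (1 : K)^'] -->
  Tweight v n1 n2 n3 m1 m2 m3.
Proof.
move=> hv.
have q1 : q @[q --> (1 : K)^'] --> (1 : K) by exact: nbhs_dnbhs.
apply: cvg_trans (cvg_Sweight_quot _ _ _ _ v n1 n2 n3 m1 m2 m3 hv q1).
(* By the conservation laws [n1 + n2 + n3] bounds every index of a denominator $(q^2; q^2)$. *)
apply: near_eq_cvg; apply: filterS (near1_qpoch_neq0 K (n1 + n2 + n3)) => q.
by case=> q0 qn0; rewrite Sweight_quotE.
Qed.

Lemma Tweight_ge0 (K : numFieldType) (v : K) n1 n2 n3 m1 m2 m3 :
  0 <= v -> v <= 1 -> 0 <= Tweight v n1 n2 n3 m1 m2 m3.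
Proof. by move=> v0 v1; rewrite !mulr_ge0 ?exprn_ge0 ?subr_ge0 ?ler0n. Qed.

(** * The tetrahedron equation *)
(* On monomials, a weight T acts as the algebra morphism fixing x1 and x3 and
   sending x2 to v x2 + (1 - v) x1 x3; thin is the dual action on functions of
   the exponents. *)
Fixpoint thin (F : fieldType) (v : F) (g : nat -> nat -> nat -> F)
    (n1 n2 n3 : nat) : F :=
  if n2 is n.+1 then
    v * thin F v (fun a b c => g a b.+1 c) n1 n n3 +
    (1 - v) * thin F v (fun a b c => g a.+1 b c.+1) n1 n n3
  else g n1 0%N n3.
Arguments thin {F} v g n1 n2 n3.

Lemma sum_iota_eq (V : nmodType) n k (f : nat -> V) : (k < n)%N ->
  (forall i, i != k -> f i = 0) -> \sum_(i <- iota 0 n) f i = f k.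
Proof.
move=> kn f0; rewrite (bigD1_seq k) ?iota_uniq ?mem_iota //=.
by rewrite big1 ?addr0.
Qed.

Section Thin.
Variables (F : fieldType) (v : F).
Implicit Types g h : nat -> nat -> nat -> F.

Lemma eq_thin g h n1 n2 n3 :
  (forall a b c, g a b c = h a b c) -> thin v g n1 n2 n3 = thin v h n1 n2 n3.
Proof.
elim: n2 g h => [|n IH] g h gh /=; rewrite ?gh //.
by rewrite !(IH _ _ (fun _ _ _ => gh _ _ _)).
Qed.

Lemma thinS1 g n1 n2 n3 :
  thin v g n1.+1 n2 n3 = thin v (fun a => g a.+1) n1 n2 n3.
Proof. by elim: n2 g => [|n IH] g //=; rewrite !IH. Qed.

Lemma thinS3 g n1 n2 n3 :
  thin v g n1 n2 n3.+1 = thin v (fun a b c => g a b c.+1) n1 n2 n3.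
Proof. by elim: n2 g => [|n IH] g //=; rewrite !IH. Qed.

Lemma thin_lin x y g h n1 n2 n3 :
  thin v (fun a b c => x * g a b c + y * h a b c) n1 n2 n3 =
  x * thin v g n1 n2 n3 + y * thin v h n1 n2 n3.
Proof. by elim: n2 g h => [|n IH] g h //=; rewrite !IH; ring. Qed.

(** The binomial expansion of $(v x_2 + (1-v) x_1 x_3)^{n_2}$, by induction through Pascal's
    rule. *)
Lemma thinE g n1 n2 n3 :
  thin v g n1 n2 n3 =
  \sum_(j < n2.+1) v ^+ j * (1 - v) ^+ (n2 - j) * 'C(n2, j)%:R *
                   g (n1 + (n2 - j))%N j (n3 + (n2 - j))%N.
Proof.
elim: n2 g => [|n IH] g /=.
  by rewrite big_ord1 /= subnn !addn0 bin0 !mul1r.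
rewrite !IH [RHS]big_ord_recl /= bin0 subn0 expr0.
under [X in _ = _ + X]eq_bigr => i _.
  rewrite /bump /= add1n binS natrD mulrDr mulrDl subSS; over.
rewrite big_split /= [X in _ = _ + (X + _)]big_ord_recr /=.
rewrite bin_small // mulr0 mul0r addr0.
rewrite [X in _ + _ * X]big_ord_recl /= bin0 subn0 expr0.
rewrite mulrDr addrCA; congr (_ + _).
  by rewrite exprS !addnS; ring.
rewrite addrC; congr (_ + _); rewrite mulr_sumr; apply: eq_bigr => i _.
  rewrite /bump /= add1n.
  have -> : (n - i = (n - i.+1).+1)%N by have := ltn_ord i; lia.
  by rewrite !addnS [_ ^+ (n - i.+1).+1]exprS; ring.
by rewrite [_ ^+ i.+1]exprS; ring.
Qed.

Lemma thin1 n1 n2 n3 : thin v (fun _ _ _ => 1) n1 n2 n3 = 1.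
Proof. by elim: n2 => [|n IH] //=; rewrite IH; ring. Qed.

Lemma Tweight_neq0 n1 n2 n3 m1 m2 m3 : Tweight v n1 n2 n3 m1 m2 m3 != 0 ->
  [/\ (m2 <= n2)%N, (n1 + n2 = m1 + m2)%N & (n2 + n3 = m2 + m3)%N].
Proof.
rewrite /Tweight -!natrM !mulnb mulf_eq0 negb_or => /andP[_].
by case: andP => [[/andP[-> /eqP ->] /eqP ->]|_]; rewrite // eqxx.
Qed.

(** For given [b] the conservation laws leave a single pair [a], [c], so the triple sum is that of
    [thinE]; the bounds only have to contain the support. *)
Lemma sum_Tweight g A B C n1 n2 n3 :
  (n1 + n2 < A)%N -> (n2 < B)%N -> (n2 + n3 < C)%N ->
  \sum_(a <- iota 0 A) \sum_(b <- iota 0 B) \sum_(c <- iota 0 C)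
     Tweight v n1 n2 n3 a b c * g a b c = thin v g n1 n2 n3.
Proof.
move=> hA hB hC; rewrite exchange_big /= thinE.
rewrite -(big_mkord predT (fun j => v ^+ j * (1 - v) ^+ (n2 - j) *
   'C(n2, j)%:R * g (n1 + (n2 - j))%N j (n3 + (n2 - j))%N)).
rewrite (big_nat_widen _ _ _ _ _ hB) /= /index_iota subn0 [RHS]big_mkcond.
have T0 a b c : ~ [/\ (b <= n2)%N, (n1 + n2 = a + b)%N & (n2 + n3 = b + c)%N] ->
  Tweight v n1 n2 n3 a b c = 0.
  by case: (eqVneq (Tweight v n1 n2 n3 a b c) 0) => // /Tweight_neq0 h /(_ h).
apply: eq_bigr => j _; rewrite ltnS; case: ifP => [jn2|jn2]; last first.
  rewrite big1 // => a _; rewrite big1 // => c _.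
  by rewrite T0 ?mul0r //; case; rewrite jn2.
rewrite (sum_iota_eq _ _ (n1 + (n2 - j))%N); [|by lia|] => [|a aN]; last first.
  by rewrite big1 // => c _; rewrite T0 ?mul0r // => -[]; move/eqP: aN; lia.
rewrite (sum_iota_eq _ _ (n3 + (n2 - j))%N); [|by lia|] => [|c cN]; last first.
  by rewrite T0 ?mul0r // => -[]; move/eqP: cN; lia.
rewrite /Tweight jn2.
have -> : (n1 + n2 == n1 + (n2 - j) + j)%N by apply/eqP; lia.
have -> : (n2 + n3 == j + (n3 + (n2 - j)))%N by apply/eqP; lia.
by rewrite !mulr1.
Qed.

End Thin.

(** * The two sides as compositions of substitutions *)

Section Tetrahedron.
Variables (F : fieldType) (v w : F).
Implicit Types f : nat -> nat -> nat -> nat -> nat -> nat -> F.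

(** The nesting follows the dependence of the indices: [k6] is an output of the weight on (2,4,6),
    so the weight on (3,5,6) comes innermost. *)
Definition thin_lhs f n1 n2 n3 n4 n5 n6 : F :=
  thin w (fun k1 k2 k3 =>
    thin w (fun l1 k4 k5 =>
      thin v (fun l2 l4 k6 =>
        thin v (fun l3 l5 l6 => f l1 l2 l3 l4 l5 l6) k3 k5 k6)
      k2 k4 n6)
    k1 n4 n5)
  n1 n2 n3.

Definition thin_rhs f n1 n2 n3 n4 n5 n6 : F :=
  thin v (fun k3 k5 k6 =>
    thin v (fun k2 k4 l6 =>
      thin w (fun k1 l4 l5 =>
        thin w (fun l1 l2 l3 => f l1 l2 l3 l4 l5 l6) k1 k2 k3)
      n1 k4 k5)
    n2 n4 k6)
  n3 n5 n6.

(** Raising an exponent by one multiplies the monomial by its generator, so this lemma and the five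
    after it give the images of $x_2$, $x_5$, $x_4$. Here the first weight splits $x_2$ and the
    later ones fix the results. *)
Lemma thin_lhsS2 f n1 n2 n3 n4 n5 n6 :
  thin_lhs f n1 n2.+1 n3 n4 n5 n6 =
  w * thin_lhs (fun a b => f a b.+1) n1 n2 n3 n4 n5 n6 +
  (1 - w) * thin_lhs (fun a b c => f a.+1 b c.+1) n1 n2 n3 n4 n5 n6.
Proof.
rewrite /thin_lhs /=; congr (_ * _ + _ * _); apply: eq_thin => a b c.
  by apply: eq_thin => *; rewrite thinS1.
by rewrite thinS1; apply: eq_thin => *; apply: eq_thin => *; rewrite thinS1.
Qed.

(** On this side only the last weight splits $x_2$; the combination is carried outwards by
    linearity. *)
Lemma thin_rhsS2 f n1 n2 n3 n4 n5 n6 :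
  thin_rhs f n1 n2.+1 n3 n4 n5 n6 =
  w * thin_rhs (fun a b => f a b.+1) n1 n2 n3 n4 n5 n6 +
  (1 - w) * thin_rhs (fun a b c => f a.+1 b c.+1) n1 n2 n3 n4 n5 n6.
Proof.
rewrite /thin_rhs /= -thin_lin; apply: eq_thin => a b c.
rewrite thinS1 -thin_lin; apply: eq_thin => *.
by rewrite -thin_lin; apply: eq_thin.
Qed.

Lemma thin_lhsS5 f n1 n2 n3 n4 n5 n6 :
  thin_lhs f n1 n2 n3 n4 n5.+1 n6 =
  v * thin_lhs (fun a b c d e => f a b c d e.+1) n1 n2 n3 n4 n5 n6 +
  (1 - v) * thin_lhs (fun a b c d e g => f a b c.+1 d e g.+1) n1 n2 n3 n4 n5 n6.
Proof.
rewrite /thin_lhs /= -thin_lin; apply: eq_thin => a b c.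
rewrite thinS3 -thin_lin; apply: eq_thin => *.
by rewrite -thin_lin; apply: eq_thin.
Qed.

Lemma thin_rhsS5 f n1 n2 n3 n4 n5 n6 :
  thin_rhs f n1 n2 n3 n4 n5.+1 n6 =
  v * thin_rhs (fun a b c d e => f a b c d e.+1) n1 n2 n3 n4 n5 n6 +
  (1 - v) * thin_rhs (fun a b c d e g => f a b c.+1 d e g.+1) n1 n2 n3 n4 n5 n6.
Proof.
rewrite /thin_rhs /=; congr (_ * _ + _ * _); apply: eq_thin => a b c.
  by apply: eq_thin => *; rewrite thinS3.
by rewrite thinS3; apply: eq_thin => *; apply: eq_thin => *; rewrite thinS3.
Qed.

Lemma thin_lhsS4 f n1 n2 n3 n4 n5 n6 :
  thin_lhs f n1 n2 n3 n4.+1 n5 n6 =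
  w * (v * thin_lhs (fun a b c d => f a b c d.+1) n1 n2 n3 n4 n5 n6 +
    (1 - v) * thin_lhs (fun a b c d e g => f a b.+1 c d e g.+1) n1 n2 n3 n4 n5 n6) +
  (1 - w) * (v * thin_lhs (fun a b c d e g => f a.+1 b c d e.+1 g) n1 n2 n3 n4 n5 n6 +
    (1 - v) * thin_lhs (fun a b c d e g => f a.+1 b c.+1 d e g.+1) n1 n2 n3 n4 n5 n6).
Proof.
rewrite /thin_lhs /= -!thin_lin; apply: eq_thin => a b c.
congr (_ * _ + _ * _); rewrite -thin_lin; apply: eq_thin => *.
  congr (_ * _ + _ * _); apply: eq_thin => *.
  by rewrite thinS3.
by rewrite -thin_lin; apply: eq_thin.
Qed.

Lemma thin_rhsS4 f n1 n2 n3 n4 n5 n6 :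
  thin_rhs f n1 n2 n3 n4.+1 n5 n6 =
  w * (v * thin_rhs (fun a b c d => f a b c d.+1) n1 n2 n3 n4 n5 n6 +
    (1 - v) * thin_rhs (fun a b c d e g => f a b.+1 c d e g.+1) n1 n2 n3 n4 n5 n6) +
  (1 - w) * (v * thin_rhs (fun a b c d e g => f a.+1 b c d e.+1 g) n1 n2 n3 n4 n5 n6 +
    (1 - v) * thin_rhs (fun a b c d e g => f a.+1 b c.+1 d e g.+1) n1 n2 n3 n4 n5 n6).
Proof.
rewrite /thin_rhs /= -!thin_lin; apply: eq_thin => a b c.
(* On this side $x_4$ is split first with [v] and then with [w], the opposite order to [thin_lhs];
   the four products agree after regrouping. *)
transitivity (v * thin v (fun k2 k4 l6 =>
   w * thin w (fun k1 l4 l5 =>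
      thin w (fun l1 l2 l3 => f l1 l2 l3 l4.+1 l5 l6) k1 k2 a) n1 k4 b +
   (1 - w) * thin w (fun k1 l4 l5 =>
      thin w (fun l1 l2 l3 => f l1.+1 l2 l3 l4 l5.+1 l6) k1 k2 a) n1 k4 b)
    n2 n4 c +
  (1 - v) * thin v (fun k2 k4 l6 =>
   w * thin w (fun k1 l4 l5 =>
      thin w (fun l1 l2 l3 => f l1 l2.+1 l3 l4 l5 l6.+1) k1 k2 a) n1 k4 b +
   (1 - w) * thin w (fun k1 l4 l5 =>
      thin w (fun l1 l2 l3 => f l1.+1 l2 l3.+1 l4 l5 l6.+1) k1 k2 a) n1 k4 b)
    n2 n4 c).
  congr (_ * _ + _ * _); apply: eq_thin => *.
    congr (_ * _ + _ * _); apply: eq_thin => *.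
    by rewrite thinS1.
  by rewrite -thin_lin; apply: eq_thin.
by rewrite !thin_lin; ring.
Qed.

(** Both sides obey the same recursions in [n4], [n2] and [n5], for all [f]; when these three
    vanish, both compute to [f n1 0 n3 0 0 n6]. *)
Lemma thin_tetrahedron f n1 n2 n3 n4 n5 n6 :
  thin_lhs f n1 n2 n3 n4 n5 n6 = thin_rhs f n1 n2 n3 n4 n5 n6.
Proof.
elim: n4 f => [|n4 IH] f; last by rewrite thin_lhsS4 thin_rhsS4 !IH.
elim: n2 f => [|n2 IH] f; last by rewrite thin_lhsS2 thin_rhsS2 !IH.
elim: n5 f => [|n5 IH] f //; by rewrite thin_lhsS5 thin_rhsS5 !IH.
Qed.

End Tetrahedron.

(** * From sums of finite support to nested substitutions *)

Lemma finsupported_sum (F : fieldType) (I J : choiceType) (h : J -> I)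
    (r : seq J) (f : I -> F) :
  injective h -> uniq r -> (forall i, f i != 0 -> exists2 j, j \in r & i = h j) ->
  finsupported f /\ \sum_(i \in [set: I]) f i = \sum_(j <- r) f (h j).
Proof.
move=> hI ur fr.
have fr' i : f i != 0 -> i \in map h r by move=> /fr[j jr ->]; exact: map_f.
split; first exact: (sub_finite_set fr' (finite_seq _)).
rewrite (@fsbigE _ _ _ _ _ (map h r)) ?map_inj_uniq //=; last first.
  by move=> i _; apply: contraNeq => /fr'.
by rewrite big_map; apply: eq_bigl => j; rewrite in_setT.
Qed.

(** Coordinates come in the order in which the weights produce them: three outputs of the first
    weight, two of the second, one of the third. *)
Definition box6 (A B C : nat) : seq nat6 :=
  let add (T : Type) (n : nat) (s : seq T) := allpairs pair s (iota 0 n) in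
  add _ C (add _ B (add _ B (add _ A (add _ A (iota 0 A))))).

Lemma box6_uniq A B C : uniq (box6 A B C).
Proof.
by do 5![apply: allpairs_uniq; rewrite ?iota_uniq //; last by move=> [? ?] []].
Qed.

Lemma mem_box6 A B C k1 k2 k3 k4 k5 k6 :
  [/\ (k1 < A)%N, (k2 < A)%N & (k3 < A)%N] ->
  [/\ (k4 < B)%N, (k5 < B)%N & (k6 < C)%N] ->
  (k1, k2, k3, k4, k5, k6) \in box6 A B C.
Proof.
by move=> [h1 h2 h3] [h4 h5 h6]; do 5![apply: allpairs_f; last by rewrite mem_iota];
  rewrite mem_iota.
Qed.

Lemma sum_box6 (F : fieldType) A B C (f : nat6 -> F) :
  \sum_(k <- box6 A B C) f k =
  \sum_(k1 <- iota 0 A) \sum_(k2 <- iota 0 A) \sum_(k3 <- iota 0 A)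
  \sum_(k4 <- iota 0 B) \sum_(k5 <- iota 0 B) \sum_(k6 <- iota 0 C)
    f (k1, k2, k3, k4, k5, k6).
Proof. by do 5!rewrite big_allpairs /=. Qed.

Section Tetrahedron_sums.
Variable F : fieldType.
Implicit Types v w : F.

Lemma thinZ v x g n1 n2 n3 :
  x * thin v g n1 n2 n3 = thin v (fun a b c => x * g a b c) n1 n2 n3.
Proof. by rewrite !thinE mulr_sumr; apply: eq_bigr => j _; ring. Qed.

(** In this lemma and its variants the digits name the output indices that are prescribed rather
    than summed; each is turned into a summed index with a Kronecker delta, over a range large
    enough to contain it, so that [sum_Tweight] applies. *)
Lemma sum_Tweight1 v m1 (g : nat -> nat -> F) B C n1 n2 n3 :
  (n2 < B)%N -> (n2 + n3 < C)%N ->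
  \sum_(b <- iota 0 B) \sum_(c <- iota 0 C) Tweight v n1 n2 n3 m1 b c * g b c =
  thin v (fun a b c => (a == m1)%:R * g b c) n1 n2 n3.
Proof.
move=> hB hC; rewrite -(@sum_Tweight _ _ _ (n1 + n2 + m1).+1 B C) //; last by lia.
rewrite [RHS](sum_iota_eq _ _ m1); [|by lia|] => [|a /negPf am]; last first.
  by rewrite big1 // => b _; rewrite big1 // => c _; rewrite am mul0r mulr0.
by apply: eq_bigr => b _; apply: eq_bigr => c _; rewrite eqxx mul1r.
Qed.

Lemma sum_Tweight3 v m3 (g : nat -> nat -> F) A B n1 n2 n3 :
  (n1 + n2 < A)%N -> (n2 < B)%N ->
  \sum_(a <- iota 0 A) \sum_(b <- iota 0 B) Tweight v n1 n2 n3 a b m3 * g a b =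
  thin v (fun a b c => (c == m3)%:R * g a b) n1 n2 n3.
Proof.
move=> hA hB; rewrite -(@sum_Tweight _ _ _ A B (n2 + n3 + m3).+1) //; last by lia.
apply: eq_bigr => a _; apply: eq_bigr => b _.
rewrite (sum_iota_eq _ _ m3); [|by lia|] => [|c /negPf cm]; last first.
  by rewrite cm mul0r mulr0.
by rewrite eqxx mul1r.
Qed.

Lemma sum_Tweight12 v m1 m2 (g : nat -> F) C n1 n2 n3 :
  (n2 + n3 < C)%N ->
  \sum_(c <- iota 0 C) Tweight v n1 n2 n3 m1 m2 c * g c =
  thin v (fun a b c => (a == m1)%:R * ((b == m2)%:R * g c)) n1 n2 n3.
Proof.
move=> hC; rewrite -(@sum_Tweight1 _ _ _ (n2 + m2).+1 C) //; last by lia.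
rewrite [RHS](sum_iota_eq _ _ m2); [|by lia|] => [|b /negPf bm]; last first.
  by rewrite big1 // => c _; rewrite bm mul0r mulr0.
by apply: eq_bigr => c _; rewrite eqxx mul1r.
Qed.

Lemma sum_Tweight23 v m2 m3 (g : nat -> F) A n1 n2 n3 :
  (n1 + n2 < A)%N ->
  \sum_(a <- iota 0 A) Tweight v n1 n2 n3 a m2 m3 * g a =
  thin v (fun a b c => (c == m3)%:R * ((b == m2)%:R * g a)) n1 n2 n3.
Proof.
move=> hA; rewrite -(@sum_Tweight3 _ _ _ A (n2 + m2).+1) //; last by lia.
apply: eq_bigr => a _.
rewrite (sum_iota_eq _ _ m2); [|by lia|] => [|b /negPf bm]; last first.
  by rewrite bm mul0r mulr0.
by rewrite eqxx mul1r.
Qed.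

Lemma Tweight_thin v n1 n2 n3 m1 m2 m3 :
  Tweight v n1 n2 n3 m1 m2 m3 =
  thin v (fun a b c => (a == m1)%:R * ((b == m2)%:R * (c == m3)%:R)) n1 n2 n3.
Proof.
rewrite -(@sum_Tweight12 _ _ _ (fun c => (c == m3)%:R) (n2 + n3 + m3).+1) //;
  last by lia.
rewrite (sum_iota_eq _ _ m3); [|by lia|] => [|c /negPf cm]; last by rewrite cm mulr0.
by rewrite eqxx mulr1.
Qed.

Definition delta6 (m k : nat6) : F := (k == m)%:R.

Lemma delta6E m1 m2 m3 m4 m5 m6 k1 k2 k3 k4 k5 k6 :
  delta6 (m1, m2, m3, m4, m5, m6) (k1, k2, k3, k4, k5, k6) =
  (k1 == m1)%:R * (k2 == m2)%:R * (k3 == m3)%:R *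
  (k4 == m4)%:R * (k5 == m5)%:R * (k6 == m6)%:R.
Proof. by rewrite /delta6 !xpair_eqE -!mulnb !natrM. Qed.

Lemma mulf4_neq0 (x y z t : F) :
  x * y * z * t != 0 -> [/\ x != 0, y != 0, z != 0 & t != 0].
Proof. by rewrite !mulf_eq0 !negb_or -!andbA => /and4P. Qed.

(** The conservation laws of three of the weights confine the primed indices to a box, where the
    sums collapse weight by weight; the delta at [m] selects the doubly primed indices. *)
Lemma tetra_lhs_sum v w n1 n2 n3 n4 n5 n6 m :
  finsupported (tetra_lhs v w (n1, n2, n3, n4, n5, n6) m) /\
  \sum_(k \in [set: nat6]) tetra_lhs v w (n1, n2, n3, n4, n5, n6) m k =
  thin_lhs F v w (fun l1 l2 l3 l4 l5 l6 => delta6 m (l1, l2, l3, l4, l5, l6))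
    n1 n2 n3 n4 n5 n6.
Proof.
move: m => [[[[[m1 m2] m3] m4] m5] m6].
pose A := (n1 + n2 + n3).+1; pose B := (n4 + n5).+1; pose C := (B + n6)%N.
have [|fs ->] := @finsupported_sum F _ _ id (box6 A B C)
  (tetra_lhs v w (n1, n2, n3, n4, n5, n6) (m1, m2, m3, m4, m5, m6))
  (@inj_id _) (box6_uniq A B C).
  move=> [[[[[k1 k2] k3] k4] k5] k6] /mulf4_neq0[].
  move=> /Tweight_neq0[? ? ?] /Tweight_neq0[? ? ?] _ /Tweight_neq0[? ? ?].
  exists (k1, k2, k3, k4, k5, k6) => //.
  by apply: mem_box6; split; rewrite /C /A /B; lia.
split=> //; rewrite sum_box6 /tetra_lhs /thin_lhs -(@sum_Tweight _ _ _ A A A);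
  try by rewrite /A; lia.
apply: eq_bigr => k1 _; apply: eq_bigr => k2 _; apply: eq_bigr => k3 _.
under [X in _ * X]eq_thin => l1 k4 k5.
  under eq_thin => l2 l4 k6.
    under eq_thin do rewrite delta6E.
    over.
  over.
(* The last two weights are exchanged: they alone contain [k6], which is summed innermost. *)
transitivity (Tweight w n1 n2 n3 k1 k2 k3 *
  \sum_(k4 <- iota 0 B) \sum_(k5 <- iota 0 B) Tweight w k1 n4 n5 m1 k4 k5 *
  \sum_(k6 <- iota 0 C) Tweight v k2 k4 n6 m2 m4 k6 *
  Tweight v k3 k5 k6 m3 m5 m6).
  rewrite !mulr_sumr; apply: eq_bigr => k4 _; rewrite !mulr_sumr.
  apply: eq_bigr => k5 _; rewrite !mulr_sumr; apply: eq_bigr => k6 _; ring.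
congr (_ * _).
transitivity (\sum_(k4 <- iota 0 B) \sum_(k5 <- iota 0 B)
  Tweight w k1 n4 n5 m1 k4 k5 *
  thin v (fun l2 l4 k6 => (l2 == m2)%:R * ((l4 == m4)%:R *
    Tweight v k3 k5 k6 m3 m5 m6)) k2 k4 n6).
  (* The range of [k4] is retained because $k_4 < B$ yields the bound $k_4 + n_6 < C$. *)
  rewrite big_seq [RHS]big_seq; apply: eq_bigr => k4; rewrite mem_iota => k4B.
  apply: eq_bigr => k5 _; rewrite -(@sum_Tweight12 _ _ _ _ C) //.
  by rewrite /C; lia.
rewrite sum_Tweight1; try by rewrite /B; lia.
apply: eq_thin => l1 k4 k5; rewrite thinZ; apply: eq_thin => l2 l4 k6.
rewrite Tweight_thin !thinZ; apply: eq_thin => *; ring.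
Qed.

Lemma tetra_rhs_sum v w n1 n2 n3 n4 n5 n6 m :
  finsupported (tetra_rhs v w (n1, n2, n3, n4, n5, n6) m) /\
  \sum_(k \in [set: nat6]) tetra_rhs v w (n1, n2, n3, n4, n5, n6) m k =
  thin_rhs F v w (fun l1 l2 l3 l4 l5 l6 => delta6 m (l1, l2, l3, l4, l5, l6))
    n1 n2 n3 n4 n5 n6.
Proof.
move: m => [[[[[m1 m2] m3] m4] m5] m6].
pose A := (n3 + n5 + n6).+1; pose B := (n2 + n4).+1; pose C := (B + n1)%N.
(* On this side the weights produce first [k3], [k5], [k6], then [k2], [k4], then [k1]; [h] restores
   the numerical order. *)
pose h (k : nat6) : nat6 :=
  let: (k3, k5, k6, k2, k4, k1) := k in (k1, k2, k3, k4, k5, k6).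
have hI : injective h.
  by move=> [[[[[? ?] ?] ?] ?] ?] [[[[[? ?] ?] ?] ?] ?] [] *; congr pair; subst.
have [|fs ->] := @finsupported_sum F _ _ h (box6 A B C)
  (tetra_rhs v w (n1, n2, n3, n4, n5, n6) (m1, m2, m3, m4, m5, m6))
  hI (box6_uniq A B C).
  move=> [[[[[k1 k2] k3] k4] k5] k6] /mulf4_neq0[].
  move=> /Tweight_neq0[? ? ?] /Tweight_neq0[? ? ?] /Tweight_neq0[? ? ?] _.
  exists (k3, k5, k6, k2, k4, k1) => //.
  by apply: mem_box6; split; rewrite /C /A /B; lia.
split=> //; rewrite sum_box6 /tetra_rhs /thin_rhs -(@sum_Tweight _ _ _ A A A);
  try by rewrite /A; lia.
apply: eq_bigr => k3 _; apply: eq_bigr => k5 _; apply: eq_bigr => k6 _ /=.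
under [X in _ * X]eq_thin => k2 k4 l6.
  under eq_thin => k1 l4 l5.
    under eq_thin do rewrite delta6E.
    over.
  over.
transitivity (Tweight v n3 n5 n6 k3 k5 k6 *
  \sum_(k2 <- iota 0 B) \sum_(k4 <- iota 0 B) Tweight v n2 n4 k6 k2 k4 m6 *
  \sum_(k1 <- iota 0 C) Tweight w n1 k4 k5 k1 m4 m5 *
  Tweight w k1 k2 k3 m1 m2 m3).
  rewrite !mulr_sumr; apply: eq_bigr => k2 _; rewrite !mulr_sumr.
  apply: eq_bigr => k4 _; rewrite !mulr_sumr; apply: eq_bigr => k1 _; ring.
congr (_ * _).
transitivity (\sum_(k2 <- iota 0 B) \sum_(k4 <- iota 0 B)
  Tweight v n2 n4 k6 k2 k4 m6 *
  thin w (fun k1 l4 l5 => (l5 == m5)%:R * ((l4 == m4)%:R *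
    Tweight w k1 k2 k3 m1 m2 m3)) n1 k4 k5).
  apply: eq_bigr => k2 _; rewrite big_seq [RHS]big_seq.
  apply: eq_bigr => k4; rewrite mem_iota => k4B.
  rewrite -(@sum_Tweight23 _ _ _ _ C) //.
  by rewrite /C; lia.
rewrite sum_Tweight3; try by rewrite /B; lia.
apply: eq_thin => k2 k4 l6; rewrite thinZ; apply: eq_thin => k1 l4 l5.
rewrite Tweight_thin !thinZ; apply: eq_thin => *; ring.
Qed.

End Tetrahedron_sums.

Lemma sum_Tweight_eq1 (F : fieldType) (v : F) n1 n2 n3 :
  let f (m : nat * nat * nat) := Tweight v n1 n2 n3 m.1.1 m.1.2 m.2 in
  finsupported f /\ \sum_(m \in [set: nat * nat * nat]) f m = 1.
Proof.
move=> f; pose A := (n1 + n2 + n3).+1.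
have [|||fs ->] := @finsupported_sum F _ _ id
  (allpairs pair (allpairs pair (iota 0 A) (iota 0 A)) (iota 0 A)) f.
- exact: inj_id.
- by do 2![apply: allpairs_uniq; rewrite ?iota_uniq //; last by move=> [? ?] []].
- move=> [[a b] c] T0; exists (a, b, c) => //; 
  have [? ? ?] : [/\ (b <= n2)%N, (n1 + n2 = a + b)%N & (n2 + n3 = b + c)%N].
    exact: Tweight_neq0 T0.
  by do 2![apply: allpairs_f; last by rewrite mem_iota /A; lia];
    rewrite mem_iota /A; lia.
split=> //; rewrite !big_allpairs /=.
(* The total mass is the action on the constant 1, which is preserved as $v + (1-v) = 1$. *)
rewrite -(@thin1 _ v n1 n2 n3) -(@sum_Tweight _ _ _ A A A);
  try by rewrite /A; lia.
by do 3![apply: eq_bigr => ? _]; rewrite mulr1.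
Qed.

Theorem proposition6p8 (R : realType) :
  [/\ (* v <> 1 or n3 = 0 means that the denominator (v; q^2)_(n3) of S is
         nonzero for all q <> 1 near 1 *)
      forall (v : CC R) (n1 n2 n3 m1 m2 m3 : nat),
        v <> 1 \/ n3 = 0%N ->
        Sweight q v n1 n2 n3 m1 m2 m3 @[q --> (1 : CC R)^']
          --> Tweight v n1 n2 n3 m1 m2 m3,
      forall (v : CC R) (n1 n2 n3 : nat),
        let f (m : nat * nat * nat) :=
          Tweight v n1 n2 n3 m.1.1 m.1.2 m.2 in
        finsupported f /\ \sum_(m \in [set: nat * nat * nat]) f m = 1,
      forall (v w : CC R) (n m : nat6),
        [/\ finsupported (tetra_lhs v w n m),
            finsupported (tetra_rhs v w n m)
          & \sum_(k \in [set: nat6]) tetra_lhs v w n m k =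
            \sum_(k \in [set: nat6]) tetra_rhs v w n m k]
    & forall v : CC R, 0 < v -> v < 1 ->
        forall n1 n2 n3 m1 m2 m3 : nat, 0 <= Tweight v n1 n2 n3 m1 m2 m3].
Proof.
split=> [v n1 n2 n3 m1 m2 m3|v n1 n2 n3|v w n m|v v0 v1 *].
- exact: cvg_Sweight.
- exact: sum_Tweight_eq1.
- move: n => [[[[[n1 n2] n3] n4] n5] n6].
  have [? lhsE] := @tetra_lhs_sum _ v w n1 n2 n3 n4 n5 n6 m.
  have [? rhsE] := @tetra_rhs_sum _ v w n1 n2 n3 n4 n5 n6 m.
  by split; rewrite // lhsE rhsE thin_tetrahedron.
- by apply: Tweight_ge0; exact: ltW.
Qed.
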